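(* Let $\mathcal{D}\colon\mathbf{Chm}\to\mathbf{Con}$ and $\mathcal{K}\colon\mathbf{Con}\to\mathbf{Chm}$ be the functors described in the context, with $\mathcal{D}$ left adjoint to $\mathcal{K}$, unit $\eta_\Gamma(x)=\{x\}$ and counit $\varepsilon_L(D)=\bigvee D$. The equivalence of categories arising from this adjunction (i.e. the one obtained by restricting to the full subcategories of objects at which the unit, respectively the counit, is an isomorphism) is an equivalence between the full subcategory of $\mathbf{Con}$ consisting of the locally connected lattices and the whole category $\mathbf{Chm}$ of chainmails.
   Context: Chainmails. In a poset, a mail is a non-empty set of elements having a common lower bound in the poset. A chainmail is a poset in which every mail has a join. A chainmail morphism $m\colon\Gamma_1\to\Gamma_2$ is a map between chainmails preserving joins of mails: for every mail $M$ in $\Gamma_1$, $m(\bigvee M)$ is the join of $m(M)$ in $\Gamma_2$. $\mathbf{Chm}$ is the category of chainmails and chainmail morphisms. Complete lattices. In a complete lattice $L$ with bottom $0$, a separated set is a subset $S\subseteq L$ with $0\notin S$ and $s\wedge s'=0$ for any two distinct $s,s'\in S$. An element $a\in L$ is connected if for every separated set $S$, $a\le\bigvee S$ implies $a\le s$ for some $s\in S$. A locally connected lattice is a complete lattice in which every element is a join of connected elements. A connectivity homomorphism $F\colon L\to M$ between complete lattices is a map preserving all joins whose right adjoint $F^\bullet\colon M\to L$ ($F(x)\le y\iff x\le F^\bullet(y)$) preserves joins of separated sets. $\mathbf{Con}$ is the category of complete lattices and connectivity homomorphisms. The functors. A set of elements of a poset is totally disconnected if no two distinct elements of it have a common lower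 bound in the poset. For a chainmail $\Gamma$, $\mathcal{D}(\Gamma)$ is the poset of totally disconnected subsets of $\Gamma$ (including the empty set), with $D_1\le D_2$ iff each element of $D_1$ is below some element of $D_2$; it is a complete lattice. For a chainmail morphism $m\colon\Gamma_1\to\Gamma_2$, $\mathcal{D}(m)(D_1)=\bigvee\{\{m(d)\}\mid d\in D_1\}$, the join being taken in $\mathcal{D}(\Gamma_2)$. For a complete lattice $L$, $\mathcal{K}(L)$ is the poset of connected elements of $L$ with the induced order; it is a chainmail. For a connectivity homomorphism $F\colon L_1\to L_2$, $\mathcal{K}(F)\colon\mathcal{K}(L_1)\to\mathcal{K}(L_2)$ maps $c$ to $F(c)$. These are functors and $\mathcal{D}$ is left adjoint to $\mathcal{K}$, with unit $\eta_\Gamma\colon\Gamma\to\mathcal{K}\mathcal{D}(\Gamma)$, $x\mapsto\{x\}$, and counit $\varepsilon_L\colon\mathcal{D}\mathcal{K}(L)\to L$, $D\mapsto\bigvee D$ (join in $L$). *)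

(* Defs.v *)
From HB Require Import structures.
From mathcomp Require Import all_boot all_order.
From mathcomp Require Import boolp classical_sets.
Set Implicit Arguments.
Unset Strict Implicit.
Unset Printing Implicit Defensive.
Import Order.TTheory.
Local Open Scope classical_set_scope.
Local Open Scope order_scope.

Record category := Category {
  obj :> Type;
  hom : obj -> obj -> Type;
  idm : forall a, hom a a;
  comp : forall a b c, hom b c -> hom a b -> hom a c;
  comp1m : forall a b (f : hom a b), comp (idm b) f = f;
  compm1 : forall a b (f : hom a b), comp f (idm a) = f;
  compmA : forall a b c d (h : hom c d) (g : hom b c) (f : hom a b),
    comp h (comp g f) = comp (comp h g) f }.
Arguments idm {C} a : rename.
Arguments comp {C a b c} g f : rename.

Declare Scope cat_scope.
Local Open Scope cat_scope.
Notation "g \c f" := (comp g f)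
  (at level 50, left associativity) : cat_scope.

Definition isomorphism (C : category) (a b : C) (f : hom a b) :=
  exists g : hom b a, g \c f = idm a /\ f \c g = idm b.

Record functor (C D : category) := Functor {
  fobj :> C -> D;
  fmap : forall a b, hom a b -> hom (fobj a) (fobj b);
  fmap1 : forall a, fmap (idm a) = idm (fobj a);
  fmapM : forall a b c (g : hom b c) (f : hom a b),
    fmap (g \c f) = fmap g \c fmap f }.
Arguments fmap {C D} F {a b} f : rename.

Record adjunction (C D : category) (F : functor C D) (G : functor D C) :=
  Adjunction {
  unit : forall a : C, hom a (G (F a));
  counit : forall b : D, hom (F (G b)) b;
  unit_natural : forall a a' (f : hom a a'),
    unit a' \c f = fmap G (fmap F f) \c unit a;
  counit_natural : forall b b' (g : hom b b'),
    counit b' \c fmap F (fmap G g) = g \c counit b;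
  triangleL : forall a, counit (F a) \c fmap F (unit a) = idm (F a);
  triangleR : forall b, fmap G (counit b) \c unit (G b) = idm (G b) }.

Definition adjoint_equivalence (C D : category) (F : functor C D)
    (G : functor D C) (A : adjunction F G) :=
  (forall a, isomorphism (unit A a)) /\ (forall b, isomorphism (counit A b)).

Definition full (C : category) (P : C -> Prop) : category :=
  @Category {a : C | P a} (fun a b => hom (sval a) (sval b))
    (fun a => idm (sval a)) (fun _ _ _ g f => g \c f)
    (fun a b => @comp1m C (sval a) (sval b))
    (fun a b => @compm1 C (sval a) (sval b))
    (fun a b c d => @compmA C (sval a) (sval b) (sval c) (sval d)).

(* functor_on restricts the source of a functor to a full subcategory;
   functor_into restricts its target to a full subcategory containing all
   values. *)
Definition functor_on (C D : category) (F : functor C D) (P : C -> Prop) :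
  functor (full P) D :=
  @Functor (full P) D (fun a => F (sval a)) (fun _ _ f => fmap F f)
    (fun a => fmap1 F (sval a))
    (fun a b c => @fmapM _ _ F (sval a) (sval b) (sval c)).

Definition functor_into (C D : category) (F : functor C D) (Q : D -> Prop)
    (FQ : forall a, Q (F a)) : functor C (full Q) :=
  @Functor C (full Q) (fun a => exist Q (F a) (FQ a)) (fun _ _ f => fmap F f)
    (fmap1 F) (@fmapM _ _ F).

Definition adjunction_into (C D : category) (F : functor C D)
    (G : functor D C) (A : adjunction F G) (Q : D -> Prop)
    (FQ : forall a, Q (F a)) :
  adjunction (functor_into FQ) (functor_on G Q) :=
  @Adjunction _ _ (functor_into FQ) (functor_on G Q)
    (unit A) (fun b => counit A (sval b)) (@unit_natural _ _ _ _ A)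
    (fun b b' => @counit_natural _ _ _ _ A (sval b) (sval b'))
    (triangleL A) (fun b => triangleR A (sval b)).

Definition adjunction_restr (C D : category) (F : functor C D)
    (G : functor D C) (A : adjunction F G) (P : C -> Prop) (Q : D -> Prop)
    (FQ : forall a : full P, Q (functor_on F P a))
    (GP : forall b : full Q, P (functor_on G Q b)) :
  adjunction (functor_into FQ) (functor_into GP) :=
  @Adjunction _ _ (functor_into FQ) (functor_into GP)
    (fun a => unit A (sval a)) (fun b => counit A (sval b))
    (fun a a' => @unit_natural _ _ _ _ A (sval a) (sval a'))
    (fun b b' => @counit_natural _ _ _ _ A (sval b) (sval b'))
    (fun a => triangleL A (sval a)) (fun b => triangleR A (sval b)).

Section Fixed.
Variables (C D : category) (F : functor C D) (G : functor D C).
Variable A : adjunction F G.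

Definition unit_fixed (a : C) := isomorphism (unit A a).
Definition counit_fixed (b : D) := isomorphism (counit A b).

Lemma fmap_iso (X Y : category) (H : functor X Y) (a b : X) (f : hom a b) :
  isomorphism f -> isomorphism (fmap H f).
Proof.
by case=> g [gf fg]; exists (fmap H g); rewrite -!fmapM gf fg !fmap1.
Qed.

Lemma iso_inverse (X : category) (a b : X) (f : hom a b) (g : hom b a) :
  isomorphism f -> g \c f = idm a -> isomorphism g.
Proof.
case=> h [hf fh] gf; suff -> : g = h by exists f.
by rewrite -(compm1 g) -fh compmA gf comp1m.
Qed.

Lemma iso_inverse' (X : category) (a b : X) (f : hom a b) (g : hom b a) :
  isomorphism f -> f \c g = idm b -> isomorphism g.
Proof.
case=> h [hf fh] fg; suff -> : g = h by exists f.
by rewrite -(comp1m g) -hf -compmA fg compm1.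
Qed.

Lemma counit_fixedF (a : full unit_fixed) :
  counit_fixed (functor_on F unit_fixed a).
Proof. exact: iso_inverse (fmap_iso F (proj2_sig a)) (triangleL A _). Qed.

Lemma unit_fixedG (b : full counit_fixed) :
  unit_fixed (functor_on G counit_fixed b).
Proof. exact: iso_inverse' (fmap_iso G (proj2_sig b)) (triangleR A _). Qed.

(* The adjunction restricted to the full subcategories of objects at which the
   unit, resp. the counit, is an isomorphism. *)
Definition fixed_adjunction := adjunction_restr A counit_fixedF unit_fixedG.

End Fixed.

Section Posets.
Variables (d : Order.disp_t) (T : porderType d).

Definition mail (M : set T) := M !=set0 /\ has_lbound M.

Definition totally_disconnected (D : set T) :=
  forall x y, D x -> D y -> x != y -> ~ has_lbound [set x; y].

End Posets.

(* The display and the choiceType underlying a porderType play no role: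
   morphisms ignore them, and classically every type is a choiceType. *)
Record chainmail := Chainmail {
  cm_disp : Order.disp_t;
  cm_sort :> porderType cm_disp;
  cm_complete : forall M : set cm_sort, mail M -> supremums M !=set0 }.

Definition chm_morphism (G1 G2 : chainmail) (m : G1 -> G2) :=
  forall (M : set G1) j, mail M -> supremums M j -> supremums (m @` M) (m j).

Record chm_hom (G1 G2 : chainmail) := ChmHom {
  chm_fun :> G1 -> G2;
  chm_funP : chm_morphism chm_fun }.

Lemma chm_hom_eq (G1 G2 : chainmail) (f g : chm_hom G1 G2) : f =1 g -> f = g.
Proof.
case: f g => f fP [g gP] /= /funext fg; case: _ / fg in gP *.
by congr ChmHom; exact: Prop_irrelevance.
Qed.

Lemma mail_pair (G : chainmail) (x y l : G) :
  l <= x -> l <= y -> mail [set x; y].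
Proof. by move=> lx ly; split; [exists x; left|exists l => z [|] ->]. Qed.

Lemma chm_mono (G1 G2 : chainmail) (m : chm_hom G1 G2) x y :
  x <= y -> m x <= m y.
Proof.
move=> xy; have : supremums [set x; y] y.
  by split=> [z [|] ->//|z]; apply; right.
move/(@chm_funP _ _ m _ _ (mail_pair (lexx x) xy)) => [ub _].
by apply: ub; exists x => //; left.
Qed.

Lemma mail_img (G1 G2 : chainmail) (m : chm_hom G1 G2) (M : set G1) :
  mail M -> mail (m @` M).
Proof.
move=> [[x Mx] [l lM]]; split; first by exists (m x), x.
by exists (m l) => _ [y /lM ly <-]; exact: chm_mono.
Qed.

Lemma chm_id_subproof (G : chainmail) : @chm_morphism G G id.
Proof. by move=> M j _; rewrite image_id. Qed.

Lemma chm_comp_subproof (G1 G2 G3 : chainmail) (n : chm_hom G2 G3)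
  (m : chm_hom G1 G2) : chm_morphism (n \o m).
Proof.
move=> M j Mm Mj; rewrite -image_comp; apply: chm_funP; first exact: mail_img.
exact: chm_funP.
Qed.

Definition Chm : category.
Proof.
refine (@Category chainmail chm_hom (fun G => ChmHom (@chm_id_subproof G))
  (fun _ _ _ n m => ChmHom (chm_comp_subproof n m)) _ _ _) => *;
  exact: chm_hom_eq.
Defined.

(* Finite meets, \bot and \top are determined by the order, so a tbLatticeType
   with all joins is just a complete lattice. *)
Record complete_lattice := CompleteLattice {
  cl_disp : Order.disp_t;
  cl_sort :> tbLatticeType cl_disp;
  cl_complete : forall A : set cl_sort, supremums A !=set0 }.

(* supremum takes its first argument as value on the empty set. *)
Notation Sup := (supremum \bot).

Section Sup.
Variable L : complete_lattice.
Implicit Types (A S : set L) (x y : L).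

Lemma SupP A : supremums A (Sup A).
Proof.
have [x Ax] := cl_complete A; rewrite /supremum; case: eqP => [A0|_].
  by split=> [y|y _]; rewrite ?A0 ?le0x.
by case: xgetP => [y _//|/(_ x)].
Qed.

Lemma Sup_ub A x : A x -> x <= Sup A.
Proof. by have [ub _] := SupP A => /ub. Qed.

Lemma Sup_le A y : (forall x, A x -> x <= y) -> Sup A <= y.
Proof. by have [_ ub] := SupP A => /ub. Qed.

Lemma Sup_eq A x : supremums A x -> Sup A = x.
Proof. exact: (is_subset1_supremums (SupP A)). Qed.

Definition separated S :=
  ~ S \bot /\
  forall s s', S s -> S s' -> s != s' -> (s `&` s')%O = \bot.

Definition connected_elt (a : L) :=
  forall S, separated S -> a <= Sup S -> exists2 s, S s & a <= s.

Definition locally_connected :=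
  forall x, exists2 A, A `<=` connected_elt & x = Sup A.

End Sup.

Section Connectivity.
Variables L M : complete_lattice.
Implicit Types (F : L -> M) (G : M -> L).

Definition right_adjoint F G := forall x y, F x <= y <-> x <= G y.

Definition connectivity_hom F :=
  (forall A, F (Sup A) = Sup (F @` A)) /\
  exists2 G, right_adjoint F G &
    forall S, separated S -> G (Sup S) = Sup (G @` S).

Lemma radj_monoR F G : right_adjoint F G -> {homo G : x y / x <= y}.
Proof. by move=> FG x y xy; apply/FG; apply: le_trans xy; apply/FG. Qed.

Lemma radj_monoL F G : right_adjoint F G -> {homo F : x y / x <= y}.
Proof. by move=> FG x y xy; apply/FG; apply: le_trans xy _; apply/FG. Qed.

Lemma connectivity_hom_radj F G : right_adjoint F G ->
  (forall S, separated S -> G (Sup S) <= Sup (G @` S)) -> connectivity_hom F.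
Proof.
move=> FG GS; split=> [A|].
  apply/eqP; rewrite eq_le; apply/andP; split.
    by apply/FG/Sup_le => x Ax; apply/FG/Sup_ub; exists x.
  apply/Sup_le => _ [x Ax <-]; apply: (radj_monoL FG); exact: Sup_ub.
exists G => // S Ssep; apply/eqP; rewrite eq_le GS//=.
by apply/Sup_le => _ [x Sx <-]; apply: (radj_monoR FG); exact: Sup_ub.
Qed.

End Connectivity.

Record con_hom (L M : complete_lattice) := ConHom {
  con_fun :> L -> M;
  con_funP : connectivity_hom con_fun }.

Lemma con_hom_eq (L M : complete_lattice) (f g : con_hom L M) :
  f =1 g -> f = g.
Proof.
case: f g => f fP [g gP] /= /funext fg; case: _ / fg in gP *.
by congr ConHom; exact: Prop_irrelevance.
Qed.

Lemma con_Sup (L M : complete_lattice) (F : con_hom L M) A :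
  F (Sup A) = Sup (F @` A).
Proof. by case: (con_funP F) => ->. Qed.

Lemma con_mono (L M : complete_lattice) (F : con_hom L M) :
  {homo F : x y / x <= y}.
Proof. by case: (con_funP F) => _ [G FG _]; exact: radj_monoL FG. Qed.

Lemma separated_radj (L M : complete_lattice) (F : L -> M) (G : M -> L)
    (S : set M) : right_adjoint F G ->
  (forall S', separated S' -> G (Sup S') = Sup (G @` S')) -> separated S ->
  separated (G @` S `\ \bot) /\ G (Sup S) = Sup (G @` S `\ \bot).
Proof.
move=> FG GS Ssep; split; last first.
  rewrite GS//; apply/eqP; rewrite eq_le; apply/andP; split; apply/Sup_le => x.
    move=> GSx; case: (pselect (x = \bot)) => [->|x0]; first exact: le0x.
    by apply: Sup_ub; split.
  by case=> GSx _; exact: Sup_ub.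
split=> [[_ +]|_ _ [[s Ss <-] _] [[s' Ss' <-] _] ss'].
  exact.
have sep0 : separated (set0 : set M) by split.
have G0 : G \bot = \bot.
  by have := GS _ sep0; rewrite image_set0 !supremum0.
apply/eqP; rewrite -lex0 -[leRHS]G0; apply/FG.
have /Ssep.2 <- // : s != s' by apply: contra_neq ss' => ->.
by rewrite lexI; apply/andP; split; apply/FG; rewrite (leIl, leIr).
Qed.

Lemma con_id_subproof (L : complete_lattice) : @connectivity_hom L L id.
Proof.
by apply: (@connectivity_hom_radj L L id id) => [x y|S _] //; rewrite image_id.
Qed.

Lemma con_comp_subproof (L M N : complete_lattice) (F2 : con_hom M N)
  (F1 : con_hom L M) : connectivity_hom (F2 \o F1).
Proof.
have [_ [G1 FG1 GS1]] := con_funP F1; have [_ [G2 FG2 GS2]] := con_funP F2.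
apply: (@connectivity_hom_radj _ _ _ (G1 \o G2)) => [x y|S Ssep] /=.
  by split=> [/FG2/FG1|/FG1/FG2].
have [sep ->] := separated_radj FG2 GS2 Ssep; rewrite GS1//.
by apply: Sup_le => _ [_ [[s Ss <-] _] <-]; apply: Sup_ub; exists s.
Qed.

Definition Con : category.
Proof.
refine (@Category complete_lattice con_hom
  (fun L => ConHom (@con_id_subproof L))
  (fun _ _ _ g f => ConHom (con_comp_subproof g f)) _ _ _) => *;
  exact: con_hom_eq.
Defined.

Record tdset (G : chainmail) := TDSet {
  td_set :> set G;
  td_setP : totally_disconnected td_set }.

HB.instance Definition _ (G : chainmail) := gen_eqMixin (tdset G).
HB.instance Definition _ (G : chainmail) := gen_choiceMixin (tdset G).

Section TDSet.
Variable G : chainmail.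
Implicit Types (D E : tdset G) (x y : G) (W : set G).

Lemma td_eq D x y z : td_set D x -> td_set D y -> z <= x -> z <= y -> x = y.
Proof.
move=> Dx Dy zx zy; have [//|/eqP xy] := pselect (x = y).
by case: (td_setP Dx Dy xy); exists z => t [|] ->.
Qed.

Lemma tdset_eq D E : D = E :> set G -> D = E.
Proof.
case: D E => D Dp [E Ep] /= DE; case: _ / DE in Ep *.
by congr TDSet; exact: Prop_irrelevance.
Qed.

Definition tdset_le D E := `[< forall x, td_set D x -> exists2 y, td_set E y & x <= y >].

Lemma tdset_leP D E : tdset_le D E <-> D `<=` down E.
Proof.
by split=> [/asboolP DE x /DE/downP//|DE]; apply/asboolP => x /DE/downP.
Qed.

Lemma down_le W x y : x <= y -> down W y -> down W x.
Proof. by move=> xy [z [Wz yz]]; exists z; split=> //; exact: le_trans yz. Qed.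

Lemma sub_down W x : W x -> down W x.
Proof. by exists x. Qed.

Lemma tdset_leP' D E : tdset_le D E <-> down D `<=` down E.
Proof.
split=> [/tdset_leP DE x [y [/DE Ey xy]]|DE]; first exact: down_le Ey.
by apply/tdset_leP => x /sub_down/DE.
Qed.

Lemma tdset_le_refl : reflexive tdset_le.
Proof. by move=> D; apply/tdset_leP'. Qed.

Lemma tdset_le_anti : antisymmetric tdset_le.
Proof.
have H D E : tdset_le D E -> tdset_le E D -> D `<=` E.
  move=> /asboolP DE /asboolP ED x Dx; have [y Ey xy] := DE x Dx.
  have [z Dz yz] := ED y Ey.
  have xz : x = z by apply: (td_eq Dx Dz (lexx x)); exact: le_trans yz.
  by have -> : x = y by apply/eqP; rewrite eq_le xy xz.
by move=> D E /andP[DE ED]; apply/tdset_eq/seteqP; split; exact: H.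
Qed.

Lemma tdset_le_trans : transitive tdset_le.
Proof.
move=> D E F /tdset_leP' ED /tdset_leP' DF; apply/tdset_leP'.
exact: subset_trans DF.
Qed.

Fact tdset_display : Order.disp_t. Proof. exact: Order.Disp tt tt. Qed.

HB.instance Definition _ := Order.Le_isPOrder.Build tdset_display (tdset G)
  tdset_le_refl tdset_le_anti tdset_le_trans.

Lemma td_leP D E : D <= E <-> down D `<=` down E.
Proof. exact: tdset_leP'. Qed.

Lemma td_leP' D E : D <= E <-> D `<=` down E.
Proof. exact: tdset_leP. Qed.

(* The order is carried by the maps D |-> down D and W |-> maximal elements
   of W, which are inverse bijections between the totally disconnected sets
   and the lower sets closed under joins of mails. *)
Definition mail_ideal W :=
  (forall x y, x <= y -> W y -> W x) /\
  (forall M j, mail M -> M `<=` W -> supremums M j -> W j).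

Definition maximals W : set G :=
  [set x | W x /\ forall y, W y -> x <= y -> y <= x].

Lemma maximals_td W : mail_ideal W -> totally_disconnected (maximals W).
Proof.
move=> [_ WM] x y [Wx xmax] [Wy ymax] /eqP xy [l lxy]; apply: xy.
have lx : l <= x by apply: lxy; left.
have ly : l <= y by apply: lxy; right.
have mxy := mail_pair lx ly.
have [j Mj] := cm_complete mxy; have [ub _] := Mj.
have xj : x <= j by apply: ub; left.
have yj : y <= j by apply: ub; right.
have Wj : W j by apply: (WM _ _ mxy _ Mj) => z [|] ->.
apply/eqP; rewrite eq_le (le_trans xj (ymax _ Wj yj)).
by rewrite (le_trans yj (xmax _ Wj xj)).
Qed.

Definition td_of W (WI : mail_ideal W) := TDSet (maximals_td WI).

Lemma down_td_of W (WI : mail_ideal W) : down (td_of WI) = W.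
Proof.
have [Wd WM] := WI; apply/seteqP; split=> [x [y [[Wy _] xy]]|x Wx].
  exact: Wd Wy.
pose M := [set y | W y /\ x <= y].
have mM : mail M by split; exists x => // y [].
have [j Mj] := cm_complete mM; have [ub lub] := Mj.
have xj : x <= j by apply: ub.
exists j; split=> //; split; first by apply: (WM M) => // y [].
by move=> y Wy jy; apply: ub; split=> //; exact: le_trans jy.
Qed.

Lemma td_of_leP W (WI : mail_ideal W) D : td_of WI <= D <-> W `<=` down D.
Proof. by rewrite td_leP down_td_of. Qed.

Lemma le_td_ofP W (WI : mail_ideal W) D : D <= td_of WI <-> down D `<=` W.
Proof. by rewrite td_leP down_td_of. Qed.

Lemma mail_ideal_down D : mail_ideal (down D).
Proof.
split=> [x y|M j [[x Mx] [l lM]] MD [ub lub]]; first exact: down_le.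
have [y [Dy xy]] := MD x Mx; exists y; split=> //; apply: lub => x' Mx'.
have [y' [Dy' xy']] := MD x' Mx'.
suff -> : y = y' by [].
by apply: (@td_eq D y y' l) => //; [apply: le_trans xy|apply: le_trans xy'];
  exact: lM.
Qed.

Lemma mail_ideal_bigcap (P : set (tdset G)) :
  mail_ideal (\bigcap_(D in P) down D).
Proof.
split=> [x y xy Wy D PD|M j Mm MW Mj D PD]; first exact: down_le xy (Wy D PD).
by apply: (mail_ideal_down D).2 Mm _ Mj => x /MW; apply.
Qed.

Definition tdset_inf (P : set (tdset G)) := td_of (mail_ideal_bigcap P).

Lemma le_tdset_inf (P : set (tdset G)) D : D <= tdset_inf P <-> lbound P D.
Proof.
rewrite le_td_ofP; split=> [DP E PE|DP x Dx E PE].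
  by apply/td_leP => x /DP; apply.
by have /td_leP := DP E PE; apply.
Qed.

Lemma tdset_sup (P : set (tdset G)) : supremums P (tdset_inf (ubound P)).
Proof.
split=> [D PD|D]; first by apply/le_tdset_inf => E; exact.
by have /le_tdset_inf := lexx (tdset_inf (ubound P)); apply.
Qed.

Lemma tdset_meetP D E F :
  (D <= tdset_inf [set E; F]) = (D <= E) && (D <= F).
Proof.
apply/idP/andP => [/le_tdset_inf H|[DE DF]].
  by split; apply: H; [left|right].
by apply/le_tdset_inf => X [|] ->.
Qed.

Lemma tdset_joinP D E F :
  (tdset_inf (ubound [set D; E]) <= F) = (D <= F) && (E <= F).
Proof.
have [ub lub] := tdset_sup [set D; E].
apply/idP/andP => [H|[DF EF]].
  by split; apply: le_trans H; apply: ub; [left|right].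
by apply: lub => X [|] ->.
Qed.

Lemma td_set0 : totally_disconnected (set0 : set G). Proof. by []. Qed.

Lemma tdset_le0 D : TDSet td_set0 <= D.
Proof. by apply/td_leP' => x. Qed.

Lemma tdset_le1 D : D <= tdset_inf set0.
Proof. by apply/le_tdset_inf => E. Qed.

HB.instance Definition _ :=
  Order.POrder_MeetJoin_isLattice.Build tdset_display (tdset G)
    tdset_meetP tdset_joinP.
HB.instance Definition _ :=
  Order.hasBottom.Build tdset_display (tdset G) tdset_le0.
HB.instance Definition _ :=
  Order.hasTop.Build tdset_display (tdset G) tdset_le1.

Lemma tdset_complete (P : set (tdset G)) : supremums P !=set0.
Proof. by exists (tdset_inf (ubound P)); exact: tdset_sup. Qed.

Definition Dlat := CompleteLattice tdset_complete.

Lemma td1_subproof x : totally_disconnected [set x].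
Proof. by move=> y z /= -> ->; rewrite eqxx. Qed.

(* The singleton {x} as an element of the lattice Dlat. *)
Definition td1 x : Dlat := TDSet (@td1_subproof x).

Lemma td1_le x D : td1 x <= D <-> down D x.
Proof.
by rewrite td_leP'; split=> [H|Dx y -> //]; exact: (H x erefl).
Qed.

Lemma td_separated_disj (S : set Dlat) D E x : separated S -> S D -> S E ->
  down D x -> down E x -> D = E.
Proof.
move=> [_ Ssep] SD SE Dx Ex; apply: contrapT => /eqP /(Ssep D E SD SE) DE.
have : td1 x <= (D `&` E)%O :> Dlat.
  by rewrite lexI; apply/andP; split; apply/td1_le.
by rewrite DE => /td1_le [y []].
Qed.

Lemma down_Sup_separated (S : set Dlat) x : separated S ->
  down (Sup S : Dlat) x -> exists2 D, S D & down D x.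
Proof.
move=> Ssep.
pose W := \bigcup_(D in S) down D.
have WI : mail_ideal W.
  split=> [y z yz [D SD Dz]|M j [[y My] [l lM]] MW Mj].
    by exists D => //; exact: down_le Dz.
  have [D SD Dy] := MW y My; exists D => //.
  apply: (mail_ideal_down D).2 _ _ Mj; first by split; [exists y|exists l].
  move=> z Mz; have [E SE Ez] := MW z Mz.
  suff -> : D = E by [].
  by apply: (@td_separated_disj S D E l) => //; [apply: down_le Dy|
    apply: down_le Ez]; exact: lM.
have : (Sup S : Dlat) <= td_of WI.
  by apply: Sup_le => D SD; apply/le_td_ofP => y Dy; exists D.
by move/le_td_ofP => H /H [D SD Dx]; exists D.
Qed.

End TDSet.

Section Dmap.
Variables (G1 G2 : chainmail) (m : chm_hom G1 G2).

Definition Dmap (D : Dlat G1) : Dlat G2 := Sup [set td1 (m d) | d in td_set D].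

Lemma mail_ideal_preim (E : tdset G2) : mail_ideal (m @^-1` down E).
Proof.
split=> [x y xy|M j Mm MW Mj]; first by apply: down_le; exact: chm_mono.
apply: (mail_ideal_down E).2 (mail_img m Mm) _ (@chm_funP _ _ m _ _ Mm Mj).
by move=> _ [x /MW ? <-].
Qed.

Definition Dradj (E : Dlat G2) : Dlat G1 := td_of (mail_ideal_preim E).

Lemma Dmap_radj : right_adjoint Dmap Dradj.
Proof.
move=> D E; split=> [DE|/le_td_ofP DE].
  apply/le_td_ofP => x [y [Dy xy]]; apply: (@down_le _ _ _ (m y)).
    exact: chm_mono.
  by apply/td1_le; apply: le_trans DE; apply: Sup_ub; exists y.
by apply: Sup_le => _ [x Dx <-]; apply/td1_le/DE/sub_down.
Qed.

Lemma Dmap_con : connectivity_hom Dmap.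
Proof.
apply: connectivity_hom_radj Dmap_radj _ => S Ssep.
apply/td_of_leP => x /(down_Sup_separated Ssep)[E SE Ex].
apply/td1_le; apply: (@le_trans _ _ (Dradj E)); last first.
  by apply: Sup_ub; exists E.
by apply/td1_le; rewrite /Dradj down_td_of.
Qed.

End Dmap.

Lemma td1_eq_sup (G : chainmail) (D : Dlat G) :
  Sup [set td1 d | d in td_set D] = D :> Dlat G.
Proof.
apply: Sup_eq; split=> [_ [x Dx <-]|E H]; first exact/td1_le/sub_down.
by apply/td_leP' => x Dx; apply/td1_le/H; exists x.
Qed.

Lemma Dmap1 (G1 G2 : chainmail) (m : chm_hom G1 G2) x :
  Dmap m (td1 x) = td1 (m x).
Proof. by rewrite /Dmap/= image_set1 supremum1. Qed.

Lemma Dlat_ext (G : chainmail) (L : complete_lattice)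
    (f g : con_hom (Dlat G) L) :
  (forall x, f (td1 x) = g (td1 x)) -> f = g.
Proof.
move=> fg; apply: con_hom_eq => D; rewrite -(td1_eq_sup D) !con_Sup.
congr Sup; rewrite !image_comp; apply: eq_imagel => x _ /=; exact: fg.
Qed.

Definition Dfun : functor Chm Con.
Proof.
refine (@Functor Chm Con Dlat (fun _ _ m => ConHom (Dmap_con m)) _ _).
- by move=> G; apply: Dlat_ext => x; exact: Dmap1.
- by move=> G1 G2 G3 n m; apply: Dlat_ext => x /=; rewrite !Dmap1.
Defined.

Record connected (L : complete_lattice) := Connected {
  conn_val :> L;
  conn_valP : connected_elt conn_val }.

HB.instance Definition _ (L : complete_lattice) := gen_eqMixin (connected L).
HB.instance Definition _ (L : complete_lattice) :=
  gen_choiceMixin (connected L).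

Section Connected.
Variable L : complete_lattice.
Implicit Types (c : connected L).

Lemma conn_val_inj : injective (@conn_val L).
Proof.
case=> c cP [c' cP'] /= cc; case: _ / cc in cP' *.
by congr Connected; exact: Prop_irrelevance.
Qed.

Definition conn_le c c' := conn_val c <= conn_val c'.

Lemma conn_le_refl : reflexive conn_le.
Proof. by move=> c; exact: lexx. Qed.

Lemma conn_le_anti : antisymmetric conn_le.
Proof. by move=> c c' /le_anti/conn_val_inj. Qed.

Lemma conn_le_trans : transitive conn_le.
Proof. by move=> c c' c''; exact: le_trans. Qed.

Fact conn_display : Order.disp_t. Proof. exact: Order.Disp tt tt. Qed.

HB.instance Definition _ := Order.Le_isPOrder.Build conn_display (connected L)
  conn_le_refl conn_le_anti conn_le_trans.

Lemma connected_neq0 c : conn_val c <> \bot.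
Proof.
move=> c0; have sep0 : separated (set0 : set L) by split.
by have [|s []] := @conn_valP _ c _ sep0; rewrite c0 le0x.
Qed.

Lemma conn_sup_subproof (M : set (connected L)) :
  mail M -> connected_elt (Sup (@conn_val L @` M)).
Proof.
move=> [[c Mc] [l lM]] S Ssep MS.
have H c' : M c' -> exists2 s, S s & conn_val c' <= s.
  by move=> Mc'; apply: (conn_valP Ssep); apply: le_trans MS; apply: Sup_ub;
    exists c'.
have [s Ss cs] := H c Mc; exists s => //; apply: Sup_le => _ [c' Mc' <-].
have [s' Ss' cs'] := H c' Mc'.
suff -> : s = s' by [].
apply: contrapT => /eqP /(Ssep.2 s s' Ss Ss') ss'.
apply: (@connected_neq0 l); apply/eqP; rewrite -lex0 -ss' lexI.
by rewrite (le_trans _ cs) ?(le_trans _ cs')//; exact: lM.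
Qed.

Lemma conn_supP (M : set (connected L)) (Mm : mail M) :
  supremums M (Connected (conn_sup_subproof Mm)).
Proof.
split=> [c Mc|c H]; first by apply: Sup_ub; exists c.
by apply: Sup_le => _ [c' Mc' <-]; exact: H.
Qed.

Lemma conn_complete (M : set (connected L)) : mail M -> supremums M !=set0.
Proof. by move=> Mm; eexists; exact: (conn_supP Mm). Qed.

Definition Kchm := Chainmail conn_complete.

Lemma conn_supE (M : set Kchm) j : mail M -> supremums M j ->
  conn_val j = Sup (@conn_val L @` M).
Proof. by move=> Mm /(is_subset1_supremums (conn_supP Mm)) <-. Qed.

End Connected.

Section Kmap.
Variables (L1 L2 : complete_lattice) (F : con_hom L1 L2).

Lemma Kmap_subproof (c : Kchm L1) : connected_elt (F (conn_val c)).
Proof.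
have [_ [G FG GS]] := con_funP F.
move=> S Ssep /FG; have [sep ->] := separated_radj FG GS Ssep.
by case/(conn_valP sep) => _ [[s Ss <-] _] /FG; exists s.
Qed.

Definition Kmap (c : Kchm L1) : Kchm L2 := Connected (@Kmap_subproof c).

Lemma Kmap_chm : chm_morphism Kmap.
Proof.
move=> M j Mm /(conn_supE Mm) jE; split=> [_ [c Mc <-]|c' H].
  apply: (@con_mono _ _ F); rewrite jE; apply: Sup_ub; by exists c.
rewrite /Order.le/= /conn_le/= jE con_Sup; apply: Sup_le => _ [_ [c Mc <-] <-].
by apply: (H (Kmap c)); exists c.
Qed.

End Kmap.

Definition Kfun : functor Con Chm.
Proof.
refine (@Functor Con Chm Kchm (fun _ _ F => ChmHom (Kmap_chm F)) _ _).
- by move=> L; apply: chm_hom_eq => c; exact: conn_val_inj.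
- by move=> L1 L2 L3 g f; apply: chm_hom_eq => c; exact: conn_val_inj.
Defined.

Section Unit.
Variable G : chainmail.

Lemma td1_connected (x : G) : connected_elt (td1 x).
Proof.
move=> S Ssep /td1_le/(down_Sup_separated Ssep)[D SD Dx].
by exists D => //; apply/td1_le.
Qed.

Definition eta (x : G) : Kchm (Dlat G) := Connected (@td1_connected x).

Lemma eta_chm : chm_morphism eta.
Proof.
move=> M j Mm Mj; have [ub _] := Mj; split=> [_ [x /ub xj <-]|c H].
  by apply/td1_le; exists j.
apply/td1_le; apply: (mail_ideal_down _).2 Mm _ Mj => x Mx.
by apply/td1_le; apply: (H (eta x)); exists x.
Qed.

End Unit.

Section Counit.
Variable L : complete_lattice.

Definition epsilon (D : Dlat (Kchm L)) : L := Sup (@conn_val L @` td_set D).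

Lemma mail_ideal_below (y : L) :
  mail_ideal [set c : Kchm L | conn_val c <= y].
Proof.
split=> [c c' cc' /=|M j Mm MW /(conn_supE Mm) /= ->]; first exact: le_trans.
by apply: Sup_le => _ [c Mc <-]; exact: MW.
Qed.

Lemma epsilon_radj :
  right_adjoint epsilon (fun y => td_of (mail_ideal_below y) : Dlat _).
Proof.
move=> D y; rewrite le_td_ofP; split=> [H c [c' [Dc' cc']] /=|H].
  apply: le_trans (_ : conn_val c' <= y) => //.
  by apply: le_trans H; apply: Sup_ub; exists c'.
by apply: Sup_le => _ [c Dc <-]; apply: H; exact: sub_down.
Qed.

Lemma epsilon_con : connectivity_hom epsilon.
Proof.
apply: connectivity_hom_radj epsilon_radj _ => S Ssep.
apply/td_of_leP => c /(conn_valP Ssep)[s Ss cs]; apply/td1_le.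
apply: le_trans (_ : td_of (mail_ideal_below s) <= _).
  by apply/td1_le; rewrite down_td_of.
by apply: (@Sup_ub (Dlat _)); exists s.
Qed.

Lemma epsilon1 (c : Kchm L) : epsilon (td1 c) = conn_val c.
Proof. by rewrite /epsilon/= image_set1 supremum1. Qed.

End Counit.

Definition DK_adjunction : adjunction Dfun Kfun.
Proof.
refine (@Adjunction Chm Con Dfun Kfun (fun G => ChmHom (@eta_chm G))
  (fun L => ConHom (@epsilon_con L)) _ _ _ _).
- move=> G1 G2 m; apply: chm_hom_eq => x; apply: conn_val_inj => /=.
  by rewrite Dmap1.
- move=> L1 L2 F; apply: Dlat_ext => c /=.
  by rewrite Dmap1 !epsilon1.
- by move=> G; apply: Dlat_ext => x /=; rewrite Dmap1 epsilon1.
- move=> L; apply: chm_hom_eq => c; apply: conn_val_inj => /=.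
  by rewrite epsilon1.
Defined.

(* Main.v *)
Require Import Defs.
From mathcomp Require Import all_boot.
From mathcomp Require Import all_order boolp classical_sets.

Set Implicit Arguments.
Unset Strict Implicit.
Unset Printing Implicit Defensive.

Import Order.TTheory.
Local Open Scope classical_set_scope.
Local Open Scope order_scope.

(** The restriction of an adjunction to the objects at which the unit, resp.
the counit, is invertible is always an equivalence ([fixed_equivalence]); the
content of the corollary is which objects these are.

The unit $x \mapsto \{x\}$ is invertible at every chainmail: the singletons of
a totally disconnected set $D$ are separated and have join $D$, so that a
connected $D$ lies below, hence equals, one of them ([connected_td1]).

The counit $D \mapsto \bigvee D$ takes only joins of connected elements as
values, so where it is surjective the lattice is locally connected. Conversely,
let $L$ be locally connected. The right adjoint of the counit maps $y$ to the
set of the maximal connected elements below $y$ ([components]), whose join is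
$y$ since every connected element below $y$ lies below a maximal one
([epsilon_components]). Moreover, a totally disconnected set of connected
elements is separated, because a non-zero common lower bound would have a
connected element below it ([td_separated]); hence every connected element
below $\bigvee D$ is below an element of $D$, and the components of
$\bigvee D$ are the elements of $D$ ([components_epsilon]).

In both cases the inverse function is monotone, and a bijective morphism with
monotone inverse is an isomorphism, because joins and adjoints are determined
by the order ([chm_iso], [con_iso]). *)

(** Isomorphisms in a full subcategory are those of the ambient category. *)
Lemma fixed_equivalence (C D : category) (F : functor C D) (G : functor D C)
  (A : adjunction F G) : adjoint_equivalence (fixed_adjunction A).
Proof. by split=> -[]. Qed.

Lemma chm_iso (G1 G2 : chainmail) (m : chm_hom G1 G2) (g : G2 -> G1) :
  cancel m g -> cancel g m -> {homo g : x y / x <= y} ->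
  isomorphism (C := Chm) m.
Proof.
move=> mK gK g_mono.
have gP : chm_morphism g.
  move=> M j _ [ub lub]; split=> [_ [x Mx <-]|z zM]; first exact/g_mono/ub.
  rewrite -(mK z); apply/g_mono/lub => x Mx.
  by rewrite -(gK x); apply/chm_mono/zM; exists x.
by exists (ChmHom gP); split; apply: chm_hom_eq.
Qed.

(** The given homomorphism serves as the right adjoint of its inverse; the
condition on this adjoint holds because homomorphisms preserve all joins. *)
Lemma con_iso (L1 L2 : complete_lattice) (F : con_hom L1 L2) (g : L2 -> L1) :
  cancel F g -> cancel g F -> {homo g : x y / x <= y} ->
  isomorphism (C := Con) F.
Proof.
move=> FK gK g_mono.
have gF : right_adjoint g F.
  by move=> x y; split=> [/(con_mono F)|/g_mono]; rewrite ?gK ?FK.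
have gP : connectivity_hom g.
  by apply: connectivity_hom_radj gF _ => S _; rewrite con_Sup.
by exists (ConHom gP); split; apply: con_hom_eq.
Qed.

Lemma td1_separated (G : chainmail) (D : tdset G) :
  separated [set td1 d | d in td_set D].
Proof.
split=> [[d _ d0]|_ _ [d Dd <-] [d' Dd' <-] dd'].
  have : td1 d <= \bot by rewrite d0.
  by move/td1_le => [y []].
apply: le_anti; rewrite le0x andbT; apply/td_leP' => z Iz.
have : td1 z <= (td1 d `&` td1 d')%O by exact/td1_le/sub_down.
rewrite lexI => /andP[/td1_le[_ [-> zd]] /td1_le[_ [-> zd']]].
by move/eqP: dd'; case; rewrite (td_eq Dd Dd' zd zd').
Qed.

(** Connectedness is applied to the decomposition of [D] into singletons. *)
Lemma connected_td1 (G : chainmail) (D : Dlat G) :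
  connected_elt D -> exists x, D = td1 x.
Proof.
move=> /(_ _ (td1_separated D)); rewrite td1_eq_sup => /(_ (lexx D)).
case=> _ [x Dx <-] Dle; exists x; apply: le_anti; rewrite Dle /=.
exact/td1_le/sub_down.
Qed.

Lemma eta_iso (G : Chm) : unit_fixed DK_adjunction G.
Proof.
have eta_surj (c : Kchm (Dlat G)) : exists x, eta x = c.
  have [x cx] := connected_td1 (@conn_valP _ c).
  by exists x; apply: conn_val_inj.
pose g c := sval (cid (eta_surj c)).
have gK : cancel g (@eta G) by move=> c; rewrite /g; case: cid.
have eta_le (x y : G) : eta x <= eta y -> x <= y.
  by move=> /td1_le[_ [->]].
apply: (@chm_iso _ _ _ g) => //.
  by move=> x; apply: le_anti; apply/andP; split; apply: eta_le; rewrite gK.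
by move=> c c' cc'; apply: eta_le; rewrite !gK.
Qed.

Lemma Dlat_locally_connected (G : chainmail) : locally_connected (Dlat G).
Proof.
move=> D; exists [set td1 d | d in td_set D]; last by rewrite td1_eq_sup.
by move=> _ [d _ <-]; exact: td1_connected.
Qed.

Section LocallyConnected.
Variable L : complete_lattice.
Hypothesis L_lc : locally_connected L.

(** [td_of] keeps the maximal elements of the ideal of connected elements below
[y]; in a locally connected space, with [y] an open set, these are the
connected components of [y]. *)
Definition components (y : L) : Dlat (Kchm L) := td_of (mail_ideal_below y).

(** Since [components y] and the set of all connected elements below [y] generate
the same lower set, local connectedness makes [y] the join of either. *)
Lemma epsilon_components : cancel components (@epsilon L).
Proof.
move=> y; apply: le_anti; apply/andP; split; first exact/epsilon_radj.
have [A Aconn ->] := L_lc y; apply: Sup_le => x Ax.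
(* In the form [epsilon (td1 x)], [x] is compared with [epsilon (components y)]
   by monotonicity of [epsilon]. *)
rewrite -[x]/(conn_val (Connected (Aconn x Ax))) -epsilon1.
apply: (con_mono (ConHom (@epsilon_con L))).
by apply/td1_le; rewrite down_td_of /=; exact: Sup_ub.
Qed.

(** Distinct elements of [D] have no connected lower bound, and by local connectedness
their meet is a join of connected elements, so this join is empty. *)
Lemma td_separated (D : tdset (Kchm L)) :
  separated (@conn_val L @` td_set D).
Proof.
split=> [[c _ /connected_neq0]//|_ _ [c Dc <-] [c' Dc' <-] cc'].
have [A Aconn IA] := L_lc (conn_val c `&` conn_val c')%O.
apply: le_anti; rewrite le0x andbT IA; apply: Sup_le => x Ax.
have : x <= (conn_val c `&` conn_val c')%O by rewrite IA; exact: Sup_ub.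
rewrite lexI => /andP[xc xc']; move/eqP: cc'; case; congr conn_val.
exact: (@td_eq _ D c c' (Connected (Aconn x Ax))).
Qed.

Lemma components_epsilon : cancel (@epsilon L) components.
Proof.
move=> D; apply: le_anti; apply/andP; split; last exact/epsilon_radj.
apply/td_of_leP => c /(conn_valP (td_separated D))[_ [c' Dc' <-] cc'].
by exists c'.
Qed.

Lemma epsilon_iso : counit_fixed DK_adjunction L.
Proof.
apply: (@con_iso _ _ _ components) => /=.
- exact: components_epsilon.
- exact: epsilon_components.
- exact: radj_monoR (@epsilon_radj L).
Qed.

End LocallyConnected.

(** Every element is a value of the counit, and these are joins of connected
elements by construction. *)
Lemma counit_fixed_locally_connected (L : Con) :
  counit_fixed DK_adjunction L -> locally_connected L.
Proof.
case=> g [_ epsg] y; exists (@conn_val L @` td_set (con_fun g y)).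
  by move=> _ [c _ <-]; exact: conn_valP.
exact/esym/(congr1 (fun f : con_hom L L => f y) epsg).
Qed.

Theorem corollary29 :
  [/\ adjoint_equivalence (fixed_adjunction DK_adjunction),
      forall Gamma : Chm, unit_fixed DK_adjunction Gamma,
      forall L : Con, counit_fixed DK_adjunction L <-> locally_connected L &
      exists DLC : forall Gamma : Chm, locally_connected (Dfun Gamma),
        adjoint_equivalence (adjunction_into DK_adjunction DLC)].
Proof.
split.
- exact: fixed_equivalence.
- exact: eta_iso.
- by move=> L; split; [exact: counit_fixed_locally_connected|exact: epsilon_iso].
- exists Dlat_locally_connected; split; first exact: eta_iso.
  by case=> L L_lc; exact: epsilon_iso.
Qed.
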